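(* Let $p$ be an odd prime, $n\ge 1$, and $G=\mathrm{Hol}(C_{p^n})$. For $m\ge 1$ let $\zeta_m$ denote a primitive $m$-th root of unity. The Wedderburn decomposition of the rational group algebra $\mathbb{Q}[G]$ is $$\mathbb{Q}[G]\cong\bigoplus_{d\mid\phi(p^n)}\mathbb{Q}(\zeta_d)\ \oplus\ \bigoplus_{k=1}^{n}\bigoplus_{l=0}^{n-k}M_{\phi(p^k)}\big(\mathbb{Q}(\zeta_{p^l})\big).$$
   Context: $C_m$ is the cyclic group of order $m$; $\mathrm{Hol}(C_m)=C_m\rtimes\mathrm{Aut}(C_m)$ for the natural action; $\phi$ is Euler's function; $M_m(K)$ is the algebra of $m\times m$ matrices over $K$. The isomorphism is one of $\mathbb{Q}$-algebras. *)

(* Defs.v *)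
From HB Require Import structures.
From mathcomp Require Import all_boot all_fingroup all_algebra all_solvable all_field.

Set Implicit Arguments.
Unset Strict Implicit.
Unset Printing Implicit Defensive.

Import GroupScope GRing.Theory.
Local Open Scope ring_scope.

(* The action of Aut G on G is the tautological one; an element of the group
   is a pair (a, x) with a in Aut G and x in G. *)
Definition holomorph (gT : finGroupType) (G : {group gT}) : finGroupType :=
  sdprod_groupType [Aut G].

(* The group algebra R[G] of the full group of a finGroupType: an alias of
   {ffun gT -> R}, with the convolution product instead of the pointwise one. *)
Definition group_algebra (R : Type) (gT : finGroupType) : Type :=
  {ffun gT -> R}.

Section GroupAlgebra.

Variables (R : comNzRingType) (gT : finGroupType).
Notation RG := (group_algebra R gT).
Implicit Types f g h : RG.

HB.instance Definition _ := Choice.on RG.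
HB.instance Definition _ := GRing.Zmodule.on RG.

Definition galg_one : RG := [ffun x : gT => (x == 1%g)%:R].

Definition galg_mul f g : RG :=
  [ffun x : gT => \sum_(y : gT) f y * g (y^-1 * x)%g].

Fact galg_mulA : associative galg_mul.
Proof.
move=> f g h; apply/ffunP=> x; rewrite !ffunE.
under eq_bigr => y _ do rewrite ffunE mulr_sumr.
under [RHS]eq_bigr => y _ do rewrite ffunE mulr_suml.
rewrite [RHS]exchange_big /=; apply: eq_bigr => y _.
rewrite [RHS](reindex_inj (mulgI y)) /=; apply: eq_bigr => z _.
by rewrite mulKg invMg mulrA !mulgA.
Qed.

Fact galg_mul1r : left_id galg_one galg_mul.
Proof.
move=> f; apply/ffunP=> x; rewrite !ffunE (bigD1 1%g) //= ffunE eqxx mul1r.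
rewrite invg1 mul1g big1 ?addr0 // => y /negPf y1.
by rewrite ffunE y1 mul0r.
Qed.

Fact galg_mulr1 : right_id galg_one galg_mul.
Proof.
move=> f; apply/ffunP=> x; rewrite !ffunE (bigD1 x) //= ffunE mulVg eqxx mulr1.
rewrite big1 ?addr0 // => y yx; rewrite ffunE -eq_mulVg1.
by rewrite (negPf yx) mulr0.
Qed.

Fact galg_mulDl : left_distributive galg_mul +%R.
Proof.
move=> f g h; apply/ffunP=> x; rewrite !ffunE -big_split.
by apply: eq_bigr => y _; rewrite ffunE mulrDl.
Qed.

Fact galg_mulDr : right_distributive galg_mul +%R.
Proof.
move=> f g h; apply/ffunP=> x; rewrite !ffunE -big_split.
by apply: eq_bigr => y _; rewrite ffunE mulrDr.
Qed.

Fact galg_one_neq0 : galg_one != 0.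
Proof. by apply/eqP => /ffunP/(_ 1%g)/eqP; rewrite !ffunE eqxx oner_eq0. Qed.

HB.instance Definition _ := GRing.Zmodule_isNzRing.Build RG
  galg_mulA galg_mul1r galg_mulr1 galg_mulDl galg_mulDr galg_one_neq0.

Definition galg_scale (a : R) f : RG := [ffun x : gT => a * f x].

Fact galg_scaleA a b f : galg_scale a (galg_scale b f) = galg_scale (a * b) f.
Proof. by apply/ffunP=> x; rewrite !ffunE mulrA. Qed.

Fact galg_scale1 : left_id 1 galg_scale.
Proof. by move=> f; apply/ffunP=> x; rewrite !ffunE mul1r. Qed.

Fact galg_scaleDr : right_distributive galg_scale +%R.
Proof. by move=> a f g; apply/ffunP=> x; rewrite !ffunE mulrDr. Qed.

Fact galg_scaleDl f : {morph galg_scale^~ f : a b / a + b}.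
Proof. by move=> a b; apply/ffunP=> x; rewrite !ffunE mulrDl. Qed.

HB.instance Definition _ := GRing.Zmodule_isLmodule.Build R RG
  galg_scaleA galg_scale1 galg_scaleDr galg_scaleDl.

Fact galg_scaleAl (a : R) f g : a *: (f * g) = (a *: f) * g.
Proof.
apply/ffunP=> x; rewrite !ffunE mulr_sumr.
by apply: eq_bigr => y _; rewrite ffunE mulrA.
Qed.

HB.instance Definition _ := GRing.Lmodule_isLalgebra.Build R RG galg_scaleAl.

Fact galg_scaleAr (a : R) f g : a *: (f * g) = f * (a *: g).
Proof.
apply/ffunP=> x; rewrite !ffunE mulr_sumr.
by apply: eq_bigr => y _; rewrite ffunE mulrCA.
Qed.

HB.instance Definition _ := GRing.Lalgebra_isAlgebra.Build R RG galg_scaleAr.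

End GroupAlgebra.

(* M_m(A) as an algebra over the base ring R of A (the matrix library only
   makes it a module over A). It is given a ring and an R-module structure, but
   no algType structure, because algType excludes the zero ring, the case
   m = 0; the same holds for direct_sum below, with an empty index set. *)
Definition matrix_algebra (A : Type) (m : nat) : Type := 'M[A]_m.

Section MatrixAlgebra.

Variable m : nat.

HB.instance Definition _ (A : choiceType) := Choice.on (matrix_algebra A m).
HB.instance Definition _ (A : zmodType) :=
  GRing.Zmodule.on (matrix_algebra A m).
HB.instance Definition _ (A : pzRingType) :=
  GRing.PzRing.on (matrix_algebra A m).

Section Scale.

Variables (R : pzRingType) (A : lmodType R).
Notation MA := (matrix_algebra A m).
Implicit Types M N : MA.

Definition matalg_scale (a : R) M : MA := map_mx ( *:%R a) (M : 'M[A]_m).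

Fact matalg_scaleA a b M :
  matalg_scale a (matalg_scale b M) = matalg_scale (a * b) M.
Proof. by apply/matrixP=> i j; rewrite !mxE scalerA. Qed.

Fact matalg_scale1 : left_id 1 matalg_scale.
Proof. by move=> M; apply/matrixP=> i j; rewrite !mxE scale1r. Qed.

Fact matalg_scaleDr : right_distributive matalg_scale +%R.
Proof. by move=> a M N; apply/matrixP=> i j; rewrite !mxE scalerDr. Qed.

Fact matalg_scaleDl M : {morph matalg_scale^~ M : a b / a + b}.
Proof. by move=> a b; apply/matrixP=> i j; rewrite !mxE scalerDl. Qed.

HB.instance Definition _ := GRing.Zmodule_isLmodule.Build R MA
  matalg_scaleA matalg_scale1 matalg_scaleDr matalg_scaleDl.

End Scale.

Variables (R : pzRingType) (A : algType R).
Notation MA := (matrix_algebra A m).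

Lemma matalg_scaleAl (a : R) (M N : MA) : a *: (M * N) = (a *: M) * N.
Proof.
apply/matrixP=> i j; rewrite !mxE scaler_sumr.
by apply: eq_bigr => k _; rewrite mxE scalerAl.
Qed.

Lemma matalg_scaleAr (a : R) (M N : MA) : a *: (M * N) = M * (a *: N).
Proof.
apply/matrixP=> i j; rewrite !mxE scaler_sumr.
by apply: eq_bigr => k _; rewrite mxE scalerAr.
Qed.

End MatrixAlgebra.

Definition direct_sum (I : finType) (A : I -> Type) : Type :=
  {dffun forall i, A i}.

HB.instance Definition _ (I : finType) (A : I -> choiceType) :=
  Choice.on (direct_sum A).

Section DirectSumZmodule.

Variables (I : finType) (A : I -> zmodType).
Notation S := (direct_sum A).
Implicit Types f g h : S.

Definition dsum_zero : S := [ffun i => 0 : A i].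
Definition dsum_opp f : S := [ffun i => - f i : A i].
Definition dsum_add f g : S := [ffun i => f i + g i : A i].

Fact dsum_addA : associative dsum_add.
Proof. by move=> f g h; apply/ffunP=> i; rewrite !ffunE addrA. Qed.

Fact dsum_addC : commutative dsum_add.
Proof. by move=> f g; apply/ffunP=> i; rewrite !ffunE addrC. Qed.

Fact dsum_add0 : left_id dsum_zero dsum_add.
Proof. by move=> f; apply/ffunP=> i; rewrite !ffunE add0r. Qed.

Fact dsum_addN : left_inverse dsum_zero dsum_opp dsum_add.
Proof. by move=> f; apply/ffunP=> i; rewrite !ffunE addNr. Qed.

HB.instance Definition _ :=
  GRing.isZmodule.Build S dsum_addA dsum_addC dsum_add0 dsum_addN.

End DirectSumZmodule.

Section DirectSumRing.

Variables (I : finType) (A : I -> pzRingType).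
Notation S := (direct_sum A).
Implicit Types f g h : S.

Definition dsum_one : S := [ffun i => 1 : A i].
Definition dsum_mul f g : S := [ffun i => f i * g i : A i].

Fact dsum_mulA : associative dsum_mul.
Proof. by move=> f g h; apply/ffunP=> i; rewrite !ffunE mulrA. Qed.

Fact dsum_mul1r : left_id dsum_one dsum_mul.
Proof. by move=> f; apply/ffunP=> i; rewrite !ffunE mul1r. Qed.

Fact dsum_mulr1 : right_id dsum_one dsum_mul.
Proof. by move=> f; apply/ffunP=> i; rewrite !ffunE mulr1. Qed.

Fact dsum_mulDl : left_distributive dsum_mul +%R.
Proof. by move=> f g h; apply/ffunP=> i; rewrite !ffunE mulrDl. Qed.

Fact dsum_mulDr : right_distributive dsum_mul +%R.
Proof. by move=> f g h; apply/ffunP=> i; rewrite !ffunE mulrDr. Qed.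

HB.instance Definition _ := GRing.Zmodule_isPzRing.Build S
  dsum_mulA dsum_mul1r dsum_mulr1 dsum_mulDl dsum_mulDr.

End DirectSumRing.

Section DirectSumModule.

Variables (R : pzRingType) (I : finType) (A : I -> lmodType R).
Notation S := (direct_sum A).
Implicit Types f g h : S.

Definition dsum_scale (a : R) f : S := [ffun i => a *: f i : A i].

Fact dsum_scaleA a b f : dsum_scale a (dsum_scale b f) = dsum_scale (a * b) f.
Proof. by apply/ffunP=> i; rewrite !ffunE scalerA. Qed.

Fact dsum_scale1 : left_id 1 dsum_scale.
Proof. by move=> f; apply/ffunP=> i; rewrite !ffunE scale1r. Qed.

Fact dsum_scaleDr : right_distributive dsum_scale +%R.
Proof. by move=> a f g; apply/ffunP=> i; rewrite !ffunE scalerDr. Qed.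

Fact dsum_scaleDl f : {morph dsum_scale^~ f : a b / a + b}.
Proof. by move=> a b; apply/ffunP=> i; rewrite !ffunE scalerDl. Qed.

HB.instance Definition _ := GRing.Zmodule_isLmodule.Build R S
  dsum_scaleA dsum_scale1 dsum_scaleDr dsum_scaleDl.

End DirectSumModule.

(* L = Q(z) with z a primitive m-th root of unity. *)
Definition cyclotomic_extension (m : nat) (L : fieldExtType rat) (z : L) :
  Prop := m.-primitive_root z /\ <<1; z>>%VS = fullv.

Lemma cyclotomic_extension_exists m :
  (0 < m)%N -> exists (L : fieldExtType rat) (z : L), cyclotomic_extension m z.
Proof.
move=> /C_prim_root_exists[w prim_w].
have [L [iota [[|z []] // [Dz] genL]]] := num_field_exists [:: w].
exists L, z; split; last by rewrite -genL adjoin_seq1.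
by rewrite -(fmorph_primitive_root iota) Dz.
Qed.

(* Main.v *)
From HB Require Import structures.
Require Import Defs.
From mathcomp Require Import all_boot all_fingroup all_algebra all_solvable all_field.

(** Let [N = p^n], [M = phi(N)]. The group is generated by [x] of order [N] and
    [y] of order [M] with [x y = y x^r], where [r] generates the units mod [N].
    A component [Q(zeta_d)] is reached by [x |-> 1], [y |-> zeta_d]. For
    [F = Q(zeta_(p^l))] and [m = phi(p^k)], the group acts on [F[t]/Phi_(p^k)], of
    dimension [m], with [x] acting as multiplication by [t] and [y] as
    [f(t) |-> u(t) f(t^r)]. Then [y^m] acts as the norm of [u], so one needs a [u]
    of norm [zeta_(p^l)]; this is where [p] odd is used (for [l <= k] the norm of
    [zeta_(p^k)] down to [Q(zeta_(p^l))] is [zeta_(p^l)]).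
    The resulting map is injective: after embedding everything in the algebraic
    numbers the columns [(w^i)_i], [w] a primitive [p^k]-th root of unity, are
    eigenvectors of [x] with distinct eigenvalues which [y] permutes up to
    scalars, and letting [zeta_(p^l)] run over all its conjugates the coefficients
    of an element of the kernel are values of polynomials with too many roots.
    Both sides have dimension [M N] over [Q], so the map is bijective. *)

Set Implicit Arguments.
Unset Strict Implicit.
Unset Printing Implicit Defensive.

Import GRing.Theory.

Section Preliminaries.

Local Open Scope ring_scope.

(** * Rational cyclotomic fields *)

(** Since X^m - 1 is the product of the Phi_d with d | m, [z] is a root of one of them; then z^d =
    1, and primitivity forces d = m. *)
Lemma root_Cyclotomic_prim (F : idomainType) m (z : F) :
  m.-primitive_root z -> root (map_poly intr 'Phi_m) z.
Proof.
move=> zP; have m_gt0 := prim_order_gt0 zP.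
pose P d : {poly F} := map_poly intr 'Phi_d.
have prodP d : (0 < d)%N -> \prod_(e <- divisors d) P e = 'X^d - 1.
  move=> d0; rewrite -rmorph_prod prod_Cyclotomic // rmorphB rmorph1 /=.
  by rewrite map_polyXn.
have: m.-unity_root z by exact/unity_rootP/prim_expr_order.
rewrite /root_of_unity.
rewrite -prodP // /root horner_prod => /eqP/eqP.
rewrite prodf_seq_eq0 => /hasP[d d_m /= Pd0].
rewrite -dvdn_divisors // in d_m.
have d_gt0 := dvdn_gt0 m_gt0 d_m.
have: d.-unity_root z.
  rewrite /root_of_unity -prodP // (big_rem d) /=; last by rewrite -dvdn_divisors.
  by rewrite rootM /root Pd0.
move=> /unity_rootP /eqP; rewrite -(prim_order_dvd zP) => m_d.
by have /eqP<- : d == m by rewrite eqn_dvd d_m m_d.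
Qed.

(** The gcd of [q] and Phi_m is computed over Q, and it is not constant because [z] is a common root
    in [K]. It therefore has a root in [algC], a primitive m-th root of unity, whose minimal
    polynomial Phi_m divides [q]. *)
Lemma prim_root_conj (K : fieldExtType rat) (z : K) (w : algC) m (q : {poly rat}) :
  m.-primitive_root z -> m.-primitive_root w ->
  root (map_poly (in_alg K) q) z -> root (map_poly ratr q) w.
Proof.
move=> zP wP qz.
pose Phi : {poly rat} := map_poly intr 'Phi_m.
have PhiK : map_poly (in_alg K) Phi = map_poly intr 'Phi_m.
  by rewrite -map_poly_comp; apply: eq_map_poly => a; exact: rmorph_int.
have PhiC : map_poly ratr Phi = cyclotomic w m.
  rewrite -(Cintr_Cyclotomic wP) -map_poly_comp.
  by apply: eq_map_poly => a; exact: rmorph_int.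
have gz : root (map_poly (in_alg K) (gcdp q Phi)) z.
  by rewrite gcdp_map root_gcd qz PhiK root_Cyclotomic_prim.
have [v gv] : exists v, root (map_poly (ratr : rat -> algC) (gcdp q Phi)) v.
  apply/closed_rootP; rewrite size_map_poly -(size_map_poly (in_alg K)).
  apply/eqP => /eqP/size_poly1P[c c0 Dc].
  by move: gz; rewrite Dc rootC (negPf c0).
move: gv; rewrite gcdp_map root_gcd PhiC root_cyclotomic // => /andP[qv vP].
have [pf [Dpf _] dv_pf] := minCpolyP v.
move: qv; rewrite dv_pf => /dvdpP[h ->].
rewrite rmorphM /= rootM -Dpf (minCpoly_cyclotomic vP) -(Cintr_Cyclotomic vP).
by rewrite (Cintr_Cyclotomic wP) root_cyclotomic // wP orbT.
Qed.

(** Each element of [K] is q(z) for some rational [q] and is sent to q(w). By [prim_root_conj] the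
    result does not depend on the choice of [q], which also gives additivity and
    multiplicativity. *)
Lemma cyclotomic_embedding (K : fieldExtType rat) (z : K) (w : algC) m :
  cyclotomic_extension m z -> m.-primitive_root w ->
  exists iota : {rmorphism K -> algC}, iota z = w.
Proof.
case=> zP Kz wP.
have ex x : {q : {poly rat} | x == (map_poly (in_alg K) q).[z]}.
  apply/sigW; have /Fadjoin1_polyP[q ->] : x \in <<1; z>>%VS by rewrite Kz memvf.
  by exists q.
pose q x := sval (ex x).
have qE x : (map_poly (in_alg K) (q x)).[z] = x by rewrite /q; case: (ex x) => p /= /eqP.
pose iota x := (map_poly ratr (q x)).[w].
have iotaE x h : x = (map_poly (in_alg K) h).[z] -> iota x = (map_poly ratr h).[w].
  move=> Dx; apply/eqP; rewrite -subr_eq0 -hornerN -hornerD -rmorphB /=.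
  apply: (prim_root_conj zP wP).
  by rewrite rmorphB /= /root hornerD hornerN qE Dx subrr.
have iotaB : {morph iota : x y / x - y}.
  move=> x y; rewrite (iotaE _ (q x - q y)) ?rmorphB /= ?hornerD ?hornerN //.
  by rewrite !qE.
have iotaM : {morph iota : x y / x * y}.
  by move=> x y; rewrite (iotaE _ (q x * q y)) ?rmorphM /= ?hornerM // !qE.
have iota1 : iota 1 = 1.
  by rewrite (iotaE _ 1) rmorph1 hornerC.
pose add := GRing.isZmodMorphism.Build K algC iota iotaB.
pose mul := GRing.isMonoidMorphism.Build K algC iota (iota1, iotaM).
pose iotaR : {rmorphism K -> algC} := HB.pack iota add mul.
exists iotaR; rewrite /= (iotaE _ 'X) map_polyX hornerX //.
Qed.

(** The minimal polynomial of [z] divides Phi_m. This bounds the dimension of the target from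
    above. *)
Lemma cyclotomic_dim (K : fieldExtType rat) (z : K) m :
  cyclotomic_extension m z -> (\dim {:K} <= totient m)%N.
Proof.
case=> zP Kz; rewrite -Kz dim_Fadjoin dimv1 muln1.
rewrite -ltnS -size_minPoly -size_Cyclotomic.
have Phi_neq0 : map_poly intr 'Phi_m != 0 :> {poly K}.
  by apply/monic_neq0/(monic_map (intr : {rmorphism int -> K}))/Cyclotomic_monic.
apply: leq_trans (dvdp_leq Phi_neq0 _) (size_poly _ _).
apply: minPoly_dvdp; last exact: root_Cyclotomic_prim zP.
by apply/polyOver1P; exists (map_poly intr 'Phi_m);
  rewrite -map_poly_comp; apply: eq_map_poly => a; rewrite /= -in_algE rmorph_int.
Qed.

(** * Elements of norm [zeta] *)

(** A generator of the units mod p^n reduces to one mod p^k, so the powers of [r] cover all phi(p^k)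
    units; as there are only phi(p^k) powers, none repeats. *)
Lemma perm_primitive_powers p n r k : prime p -> (0 < k <= n)%N ->
  (forall b, coprime p b -> exists j, b = r ^ j %[mod p ^ n]) ->
  coprime p r ->
  perm_eq [seq (r ^ s %% p ^ k)%N | s <- iota 0 (totient (p ^ k))]
          [seq b <- iota 0 (p ^ k) | coprime (p ^ k) b].
Proof.
move=> p_pr /andP[k_gt0 le_kn] rgen p_r.
set m := totient (p ^ k); set L := map _ _; set R := filter _ _.
have uR : uniq R by rewrite filter_uniq ?iota_uniq.
have szR : size R = m.
  rewrite size_filter -sum1_count big_mkcond /= /m totient_count_coprime.
  by rewrite /index_iota subn0; apply: eq_bigr => i _; case: coprime.
have pk_gt0 : (0 < p ^ k)%N by rewrite expn_gt0 prime_gt0.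
have sRL : {subset R <= L}.
  move=> b; rewrite mem_filter mem_iota /= add0n => /andP[].
  rewrite coprime_pexpl // => /rgen[j Dj] lt_b.
  apply/mapP; exists (j %% m)%N; first by rewrite mem_iota /= add0n ltn_mod totient_gt0.
  have Dk : b = r ^ j %[mod p ^ k].
    have /modn_dvdm <- : (p ^ k %| p ^ n)%N by rewrite dvdn_exp2l.
    by rewrite Dj modn_dvdm // dvdn_exp2l.
  rewrite -[LHS](modn_small lt_b) Dk [in LHS](divn_eq j m) expnD.
  have rp1 : r ^ m = 1 %[mod p ^ k].
    by apply: Euler_exp_totient; rewrite coprime_sym coprime_pexpl.
  by rewrite (mulnC _ m) expnM -modnMml -modnXm rp1 modnXm exp1n modnMml mul1n.
apply: uniq_perm => //.
  by apply: leq_size_uniq uR sRL _; rewrite szR size_map size_iota.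
have [|_ DL b] := uniq_min_size uR sRL; last by rewrite DL.
by rewrite szR size_map size_iota.
Qed.

(** The ratio y/e is an N-th root of unity, so its geometric sum vanishes unless it is 1. For N = 0
    both sides are 0. *)
Lemma sum_unity_root_ratio (F : fieldType) N (y e : F) :
  y ^+ N = 1 -> e ^+ N = 1 ->
  \sum_(i < N) (e^-1 * y) ^+ i = if y == e then N%:R else 0.
Proof.
move=> yN eN; case: N yN eN => [|N] yN eN; first by rewrite big_ord0 if_same.
have e0 : e != 0.
  by apply: contra_eq_neq eN => ->; rewrite expr0n eq_sym oner_eq0.
case: eqP => [->|/eqP ye].
  rewrite mulVf // (eq_bigr (fun=> 1)) => [|i _]; last by rewrite expr1n.
  by rewrite sumr_const card_ord.
have ye1 : e^-1 * y - 1 != 0.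
  by rewrite subr_eq0; apply: contra ye => /eqP/(canRL (mulKf (invr_neq0 e0)))->;
    rewrite invrK mulr1.
apply: (mulfI ye1); rewrite -subrX1 mulr0 exprMn exprVn yN eN invr1 mulr1.
by rewrite subrr.
Qed.

(* The norm of [u] from [F[t]/Phi_(p^k)] down to [F] is [z]: this is what splits the
   cyclic algebra [(Q(zeta_(p^k)) (x) F / F, z)]. *)
Lemma exists_norm_zeta (F : fieldExtType rat) (z : F) p k l :
  prime p -> odd p -> (0 < k)%N -> (p ^ l).-primitive_root z ->
  exists u : {poly F}, forall (iota : {rmorphism F -> algC}) w,
    (p ^ k).-primitive_root w ->
    \prod_(b < p ^ k | coprime (p ^ k) b) (map_poly iota u).[w ^+ b] = iota z.
Proof.
move=> p_pr p_odd k_gt0 zP.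
have p_gt0 : (0 < p)%N by exact: prime_gt0.
have [l0|l_gt0] := posnP l.
  exists 1 => iota w _; rewrite rmorph1 big1 => [|b _]; last by rewrite hornerC.
  by move: zP; rewrite l0 expn0 => /prim_expr_order; rewrite expr1 => ->; rewrite rmorph1.
(* [delta j e] evaluates to 1 at [e] and to 0 at the other [p ^ j]-th roots of unity. *)
pose delta j (e : F) : {poly F} :=
  ((p ^ j)%N%:R^-1)%:P * \sum_(i < p ^ j) (e^-1 *: 'X) ^+ i.
have deltaE (iota : {rmorphism F -> algC}) j e y :
    e ^+ (p ^ j) = 1 -> y ^+ (p ^ j) = 1 ->
    (map_poly iota (delta j e)).[y] = (y == iota e)%:R.
  move=> eN yN; rewrite rmorphM /= hornerM map_polyC /= hornerC fmorphV rmorph_nat.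
  rewrite rmorph_sum horner_sum.
  under eq_bigr => i _ do
    rewrite rmorphXn /= map_polyZ map_polyX horner_exp hornerZ hornerX fmorphV.
  rewrite sum_unity_root_ratio //; last by rewrite -rmorphXn eN rmorph1.
  case: eqP; rewrite ?mulr0 // mulVf // Num.Theory.pnatr_eq0 -lt0n expn_gt0 p_gt0 //.
have [le_lk|lt_kl] := leqP l k.
  pose q := (p ^ (k - l))%N.
  have qpl : (q * p ^ l = p ^ k)%N by rewrite -expnD subnK.
  (* At w^b this takes the value w^b if (w^b)^q is the image of z, and 1 otherwise. The product is
     thus the norm of a primitive p^k-th root of unity down to the p^l-th cyclotomic field. *)
  exists (1 + ('X - 1) * (delta l z \Po 'X^q)) => iota w wP.
  have wqP : (p ^ l).-primitive_root (w ^+ q).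
    have -> : (q = p ^ k %/ p ^ l)%N by rewrite -qpl mulnK // expn_gt0 p_gt0.
    exact: dvdn_prim_root wP _ (dvdn_exp2l p le_lk).
  have [a Da] := prim_rootP wqP (etrans (esym (rmorphXn iota _ _))
    (etrans (congr1 iota (prim_expr_order zP)) (rmorph1 iota))).
  have a_co : coprime (p ^ l) a.
    have := zP; rewrite -(fmorph_primitive_root iota) Da prim_root_exp_coprime //.
    by rewrite coprime_sym.
  rewrite (eq_bigr (fun b : 'I_(p ^ k) =>
    if b == a %[mod p ^ l] then w ^+ b else 1)); last first.
    move=> b _; rewrite rmorphD rmorphM rmorphB rmorph1 /= map_polyX.
    rewrite map_comp_poly map_polyXn.
    rewrite hornerD hornerC hornerM hornerD hornerN hornerX hornerC horner_comp hornerXn.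
    rewrite deltaE ?(prim_expr_order zP) //; last first.
      by rewrite -!exprM qpl mulnC exprM (prim_expr_order wP) expr1n.
    rewrite exprAC Da (eq_prim_root_expr wqP).
    by case: eqP; rewrite ?mulr1 ?mulr0 ?addr0 // addrC subrK.
  rewrite -big_mkcondr /=.
  (* The remaining indices are b = a + p^l c with c < q. *)
  have h_lt (c : 'I_q) : (a + p ^ l * c < p ^ k)%N.
    apply: (@leq_trans (p ^ l * c.+1)); first by rewrite mulnS ltn_add2r.
    by rewrite -qpl [leqRHS]mulnC leq_mul2l ltn_ord orbT.
  have h'_lt (b : 'I_(p ^ k)) : (b %/ p ^ l < q)%N.
    by rewrite ltn_divLR ?expn_gt0 ?p_gt0 // qpl.
  rewrite (reindex_onto (fun c => Ordinal (h_lt c)) (fun b => Ordinal (h'_lt b))) /=;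
    last first.
    move=> b /andP[_ /eqP Db]; apply: val_inj => /=.
    by rewrite -[a : nat](modn_small (ltn_ord a)) -Db addnC mulnC -divn_eq.
  rewrite (eq_bigl xpredT) => [|c]; last first.
    apply/andP; split; last first.
      apply/eqP/val_inj => /=.
      by rewrite addnC mulnC divnMDl ?expn_gt0 ?p_gt0 // divn_small ?addn0.
    rewrite addnC mulnC modnMDl eqxx andbT coprime_pexpl //.
    by rewrite -(@coprime_pexpl l) // -coprime_modr modnMDl coprime_modr.
  rewrite prodrXr big_split /= sum_nat_const card_ord -big_distrr /=.
  rewrite exprD exprM -Da.
  (* The sum is q(q-1)/2, a multiple of q because q is odd; and p^l q = p^k. *)
  suff -> : w ^+ (p ^ l * \sum_(i < q) i) = 1 by rewrite mulr1.
  apply/eqP; rewrite -(prim_order_dvd wP) -(big_mkord xpredT id) bin2_sum.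
  by rewrite bin2odd ?oddX ?p_odd ?orbT // mulnA (mulnC _ q) qpl dvdn_mulr.
(* Here l > k, so [F] contains the primitive p^k-th root of unity z^(p^(l-k)). The polynomial is z
   there and 1 at the other conjugates, hence a single factor of the product differs from 1. *)
exists (1 + (z%:P - 1) * delta k (z ^+ (p ^ (l - k)))) => iota w wP.
have eP : (p ^ k).-primitive_root (iota (z ^+ (p ^ (l - k)))).
  rewrite fmorph_primitive_root.
  have -> : (p ^ (l - k) = p ^ l %/ p ^ k)%N by rewrite expnB // ltnW.
  exact: dvdn_prim_root zP _ (dvdn_exp2l p (ltnW lt_kl)).
have [a Da] := prim_rootP wP (prim_expr_order eP).
have a_co : coprime (p ^ k) a.
  by move: eP; rewrite Da prim_root_exp_coprime // coprime_sym.
have uE (b : 'I_(p ^ k)) :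
    (map_poly iota (1 + (z%:P - 1) * delta k (z ^+ (p ^ (l - k))))).[w ^+ b]
    = if b == a then iota z else 1.
  rewrite rmorphD rmorphM rmorphB rmorph1 /= map_polyC.
  rewrite hornerD hornerC hornerM hornerD hornerN !hornerC.
  rewrite deltaE; last 2 first.
  - by apply: (fmorph_inj iota); rewrite rmorphXn (prim_expr_order eP) rmorph1.
  - by rewrite exprAC (prim_expr_order wP) expr1n.
  rewrite Da (eq_prim_root_expr wP) !modn_small // -val_eqE /=.
  by case: eqP; rewrite ?mulr1 ?mulr0 ?addr0 // addrC subrK.
rewrite (bigD1 a) //= uE eqxx big1 ?mulr1 // => b /andP[_ /negPf ba].
by rewrite uE ba.
Qed.

(** * Induced representations *)

Lemma map_mx_expr (F K : fieldType) (iota : {rmorphism F -> K}) m (A : 'M[F]_m) i :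
  map_mx iota (A ^+ i) = map_mx iota A ^+ i.
Proof.
by elim: i => [|i IHi]; rewrite ?expr0 ?map_mx1 // !exprS -!mulmxE map_mxM IHi.
Qed.

(** Matrix of the linear map t^i |-> q_i on F[t]/Phi, with images stored as rows, so that
    multiplying by the column of the w^i evaluates them at t = w. *)
Definition modp_mx (F : fieldType) m (Phi : {poly F}) (q : nat -> {poly F}) :
  'M[F]_m := \matrix_(i < m) poly_rV (q i %% Phi).

Definition powers_col m (w : algC) : 'cV[algC]_m := \col_i w ^+ i.

(** Reduction modulo [Phi] does not change the value at a root of [Phi]. *)
Lemma map_modp_mx_powers (F : fieldType) (iota : {rmorphism F -> algC}) m
    (Phi : {poly F}) q (w : algC) :
  size Phi = m.+1 -> root (map_poly iota Phi) w ->
  map_mx iota (modp_mx m Phi q) *m powers_col m w =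
  \col_i (map_poly iota (q i)).[w].
Proof.
move=> szPhi /eqP Phi_w; apply/colP => i; rewrite !mxE.
rewrite [in RHS](divp_eq (q i) Phi) rmorphD rmorphM /= hornerD hornerM Phi_w.
rewrite mulr0 add0r (@horner_coef_wide _ m); last first.
  by rewrite size_map_poly -ltnS -szPhi ltn_modp -size_poly_gt0 szPhi.
by apply: eq_bigr => j _; rewrite !mxE coef_map.
Qed.

Section PrimitivePowers.

Variables (p n r k : nat) (w : algC).
Hypotheses (p_pr : prime p) (k_in : (0 < k <= n)%N).
Hypothesis rgen : forall b, coprime p b -> exists j, b = r ^ j %[mod p ^ n].
Hypotheses (p_r : coprime p r) (wP : (p ^ k).-primitive_root w).
Let m := totient (p ^ k).

Lemma prim_root_exp_gen j : (p ^ k).-primitive_root (w ^+ (r ^ j)).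
Proof.
by rewrite prim_root_exp_coprime // coprime_sym coprimeXl // coprimeXr.
Qed.

Lemma prod_primitive_powers (R : comNzRingType) (f : algC -> R) :
  \prod_(s < m) f (w ^+ (r ^ s)) =
  \prod_(b < p ^ k | coprime (p ^ k) b) f (w ^+ b).
Proof.
rewrite -[RHS](big_mkord (fun b => coprime (p ^ k) b) (fun b => f (w ^+ b))).
rewrite -big_filter /index_iota subn0.
rewrite -(perm_big _ (perm_primitive_powers p_pr k_in rgen p_r)) big_map /=.
rewrite -(big_mkord xpredT (fun s => f (w ^+ (r ^ s)))) /index_iota subn0.
by apply: eq_bigr => s _; rewrite (prim_expr_mod wP).
Qed.

(** The nodes are distinct by [perm_primitive_powers], so the columns form a basis: matrices can be
    compared on them, and linear relations among them are trivial. *)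
Let V : 'M[algC]_m := Vandermonde m (\row_(j < m) w ^+ (r ^ j)).

Let V_unit : V \in unitmx.
Proof.
rewrite unitmxE det_Vandermonde unitfE.
apply/prodf_neq0 => i _; apply/prodf_neq0 => j lt_ij.
rewrite !mxE subr_eq0 (eq_prim_root_expr wP); apply/negP => Eij.
have: uniq [seq (r ^ s %% p ^ k)%N | s <- iota 0 m].
  rewrite (perm_uniq (perm_primitive_powers p_pr k_in rgen p_r)).
  by rewrite filter_uniq ?iota_uniq.
move/(uniqP 0%N)/(_ j i); rewrite !inE size_map size_iota !ltn_ord.
rewrite !(nth_map 0%N) ?size_iota // !nth_iota // !add0n.
by move=> /(_ isT isT (eqP Eij)) Dij; rewrite Dij ltnn in lt_ij.
Qed.

Let col_V j : col j V = powers_col m (w ^+ (r ^ j)).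
Proof. by apply/colP => i; rewrite !mxE. Qed.

Lemma powers_col_ext (A B : 'M[algC]_m) :
  (forall j, A *m powers_col m (w ^+ (r ^ j)) = B *m powers_col m (w ^+ (r ^ j))) ->
  A = B.
Proof.
move=> AB; apply: (can_inj (mulmxK V_unit)).
apply/matrixP => i j; have /colP/(_ i) := AB j; rewrite -col_V !mxE.
by under eq_bigr do rewrite mxE; under [X in _ = X -> _]eq_bigr do rewrite mxE.
Qed.

Lemma powers_col_free (c : 'I_m -> algC) :
  \sum_(j < m) c j *: powers_col m (w ^+ (r ^ j)) = 0 -> forall j, c j = 0.
Proof.
move=> cV j; suff /colP/(_ j) : \col_i c i = 0 by rewrite !mxE.
apply: (can_inj (mulKmx V_unit)); rewrite mulmx0 -cV.
apply/colP => i; rewrite !mxE summxE.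
by apply: eq_bigr => s _; rewrite !mxE mulrC.
Qed.

End PrimitivePowers.

(* On the columns [(w ^ i)_i], [X] and [Y] act like multiplication by [t] and
   [f(t) |-> u(t) f(t^r)] on [F[t]/Phi_{p^k}], evaluated at [t = w]. *)
Definition induced_action p k r (z : algC) (u : algC -> algC)
    (X Y : 'M[algC]_(totient (p ^ k))) :=
  forall w, (p ^ k).-primitive_root w ->
  let E v := powers_col (totient (p ^ k)) v in
  [/\ X *m E w = w *: E w, Y *m E w = u w *: E (w ^+ r) &
      \prod_(s < totient (p ^ k)) u (w ^+ (r ^ s)) = z].


Section InducedAction.

Variables (p n r k : nat) (z : algC) (u : algC -> algC).
Let m := totient (p ^ k).
Variables X Y : 'M[algC]_m.
Hypotheses (p_pr : prime p) (k_in : (0 < k <= n)%N).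
Hypothesis rgen : forall b, coprime p b -> exists j, b = r ^ j %[mod p ^ n].
Hypotheses (p_r : coprime p r) (XY : @induced_action p k r z u X Y).
Local Notation E := (powers_col m).

Let pk_gt0 : (0 < p ^ k)%N.
Proof. by rewrite expn_gt0 prime_gt0. Qed.

Lemma induced_actionX i w :
  (p ^ k).-primitive_root w -> X ^+ i *m E w = w ^+ i *: E w.
Proof.
move=> wP; have [Xw _ _] := XY wP; elim: i => [|i IHi].
  by rewrite !expr0 mul1mx scale1r.
by rewrite exprSr -mulmxE -mulmxA Xw -scalemxAr IHi scalerA -exprS.
Qed.

Lemma induced_actionY j w : (p ^ k).-primitive_root w ->
  Y ^+ j *m E w = (\prod_(s < j) u (w ^+ (r ^ s))) *: E (w ^+ (r ^ j)).
Proof.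
elim: j w => [|j IHj] w wP; first by rewrite expr0 mul1mx big_ord0 scale1r.
have [_ Yw _] := XY wP.
rewrite exprSr -mulmxE -mulmxA Yw -scalemxAr.
rewrite IHj; last by rewrite -[r]expn1 (prim_root_exp_gen p_r).
rewrite scalerA big_ord_recl expr1 /=; congr (_ * _ *: E _).
  by apply: eq_bigr => s _; rewrite -exprM -expnS.
by rewrite -exprM -expnS.
Qed.

Lemma expr_gen_totient (w : algC) : (p ^ k).-primitive_root w ->
  w ^+ (r ^ m) = w.
Proof.
move=> wP; have rm1 : r ^ m = 1 %[mod p ^ k].
  by apply: Euler_exp_totient; rewrite coprimeXr // coprime_sym.
by rewrite -(prim_expr_mod wP) rm1 (prim_expr_mod wP).
Qed.

(** Since r^m = 1 mod p^k, m applications of [Y] bring each basis column back to itself, multiplied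
    by the full product of the values of [u]. *)
Lemma induced_action_scalar : Y ^+ m = z%:M.
Proof.
have [w wP] := C_prim_root_exists pk_gt0.
apply: (powers_col_ext p_pr k_in rgen p_r wP) => j.
have wjP := prim_root_exp_gen p_r wP j.
have [_ _ Nz] := XY wjP.
by rewrite induced_actionY // Nz expr_gen_totient // mul_scalar_mx.
Qed.

Lemma induced_action_conj : X * Y = Y * X ^+ r.
Proof.
have [w wP] := C_prim_root_exists pk_gt0.
apply: (powers_col_ext p_pr k_in rgen p_r wP) => j.
have wjP := prim_root_exp_gen p_r wP j.
have wjrP : (p ^ k).-primitive_root (w ^+ (r ^ j) ^+ r).
  by rewrite -exprM -expnSr (prim_root_exp_gen p_r).
have [_ Yw _] := XY wjP; have [Xw _ _] := XY wjrP.
rewrite -!mulmxE -!mulmxA induced_actionX // Yw -!scalemxAr Yw Xw.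
by rewrite !scalerA mulrC.
Qed.

Lemma induced_action_exprX : X ^+ (p ^ n) = 1.
Proof.
have [w wP] := C_prim_root_exists pk_gt0.
apply: (powers_col_ext p_pr k_in rgen p_r wP) => j.
have wjP := prim_root_exp_gen p_r wP j.
rewrite induced_actionX // mul1mx; case/andP: k_in => _ /subnK <-.
by rewrite addnC expnD exprM (prim_expr_order wjP) expr1n scale1r.
Qed.

Lemma totient_pfactor_mul : totient (p ^ n) = (p ^ (n - k) * m)%N.
Proof.
case/andP: k_in => k_gt0 le_kn.
rewrite /m !totient_pfactor // ?(leq_trans k_gt0) // mulnCA; congr (_ * _)%N.
by rewrite -expnD; congr (_ ^ _)%N; rewrite -subn1 -subn1 addnBA // subnK.
Qed.

(** Apply the relation to the eigenvector E(w) and split the exponent of [Y] as t m + j: Y^(t m) is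
    the scalar z^t, while Y^j leads to a multiple of E(w^(r^j)). These columns are independent, so
    each j gives its own equation. *)
Lemma induced_action_free (c : nat -> nat -> algC) w :
  z != 0 -> (p ^ k).-primitive_root w ->
  \sum_(j < totient (p ^ n)) \sum_(i < p ^ n) c j i *: (Y ^+ j * X ^+ i) = 0 ->
  forall j : 'I_m,
  \sum_(t < p ^ (n - k)) (\sum_(i < p ^ n) c (t * m + j)%N i * w ^+ i) * z ^+ t = 0.
Proof.
move=> z_neq0 wP cXY j; have [_ _ Nz] := XY wP.
pose U s := \prod_(b < s) u (w ^+ (r ^ b)).
pose P s := \sum_(i < p ^ n) c s i * w ^+ i.
have sumE : \sum_(s < totient (p ^ n)) (P s) *: (Y ^+ s *m E w) = 0.
  rewrite -[RHS](mul0mx _ (E w)) -cXY mulmx_suml; apply: eq_bigr => s _.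
  rewrite mulmx_suml scaler_suml; apply: eq_bigr => i _.
  by rewrite -scalemxAl -mulmxE -mulmxA induced_actionX // -scalemxAr scalerA.
(* The factor U(j) can be cancelled: it is a partial product of the nonzero z. *)
suff DU : forall s : 'I_m, (\sum_(t < p ^ (n - k)) P (t * m + s)%N * z ^+ t) * U s = 0.
  apply/eqP; move/eqP: (DU j); rewrite mulf_eq0 => /orP[// | /eqP Uj0].
  case/eqP: z_neq0; rewrite -Nz (bigID (fun b : 'I_m => (b < j)%N)) /=.
  rewrite -[X in X * _](big_ord_widen _ (fun b => u (w ^+ (r ^ b)))); last exact: ltnW.
  by rewrite -/(U j) Uj0 mul0r.
apply: (powers_col_free p_pr k_in rgen p_r wP).
rewrite -[RHS]sumE -[RHS](big_mkord xpredT (fun s => P s *: (Y ^+ s *m E w))).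
rewrite totient_pfactor_mul big_nat_mul big_mkord.
rewrite [RHS](eq_bigr (fun t : 'I__ => \sum_(i < m) (P (t * m + i)%N * z ^+ t * U i) *:
    E (w ^+ (r ^ i)))) => [|t _]; last first.
  rewrite mulSn addnC -{1}[(t * m)%N]add0n big_addn addKn big_mkord.
  apply: eq_bigr => i _; rewrite exprD (mulnC t) exprM induced_action_scalar.
  rewrite -mulmxE -mulmxA -rmorphXn /= mul_scalar_mx -scalemxAr induced_actionY //.
  by rewrite !scalerA (addnC i) (mulnC m).
rewrite exchange_big; apply: eq_bigr => i _ /=.
by rewrite -scaler_suml mulr_suml.
Qed.

End InducedAction.

(** The relations hold over [F] as soon as they hold after one embedding into [algC]. The last
    clause covers all embeddings because injectivity needs every conjugate of [z]. *)
Lemma exists_induced_rep (F : fieldExtType rat) (z : F) p n r k l :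
  prime p -> odd p -> (0 < k <= n)%N -> (l <= n - k)%N ->
  (forall b, coprime p b -> exists j, b = r ^ j %[mod p ^ n]) ->
  coprime p r -> cyclotomic_extension (p ^ l) z ->
  exists X Y : 'M[F]_(totient (p ^ k)),
    [/\ X ^+ (p ^ n) = 1, Y ^+ totient (p ^ n) = 1, X * Y = Y * X ^+ r &
     forall iota : {rmorphism F -> algC}, exists u : algC -> algC,
       @induced_action p k r (iota z) u (map_mx iota X) (map_mx iota Y)].
Proof.
move=> p_pr p_odd k_in le_l rgen p_r zF; have [zP _] := zF.
have k_gt0 : (0 < k)%N by case/andP: k_in.
set m := totient (p ^ k).
pose Phi : {poly F} := map_poly intr 'Phi_(p ^ k).
have szPhi : size Phi = m.+1.
  rewrite size_map_poly_id0 ?size_Cyclotomic //.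
  by rewrite (eqP (Cyclotomic_monic _)) oner_eq0.
have Phi_w (iota : {rmorphism F -> algC}) w :
    (p ^ k).-primitive_root w -> root (map_poly iota Phi) w.
  move=> wP; have := root_Cyclotomic_prim wP.
  rewrite -map_poly_comp (@eq_map_poly _ _ _ intr) // => a; exact: rmorph_int.
have [u0 u0N] := exists_norm_zeta p_pr p_odd k_gt0 zP.
pose X : 'M[F]_m := modp_mx m Phi (fun i => 'X^(i.+1)).
pose Y : 'M[F]_m := modp_mx m Phi (fun i => u0 * 'X^(r * i)).
have XY (iota : {rmorphism F -> algC}) :
    @induced_action p k r (iota z) (horner (map_poly iota u0))
      (map_mx iota X) (map_mx iota Y).
  move=> w wP E; split.
  - rewrite map_modp_mx_powers ?Phi_w //; apply/colP => i.
    by rewrite !mxE map_polyXn hornerXn exprS.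
  - rewrite map_modp_mx_powers ?Phi_w //; apply/colP => i.
    by rewrite !mxE rmorphM /= hornerM map_polyXn hornerXn exprM.
  rewrite (prod_primitive_powers p_pr k_in rgen p_r wP (horner (map_poly iota u0))).
  exact: u0N.
have pl_gt0 : (0 < p ^ l)%N by rewrite expn_gt0 prime_gt0.
have [v vP] := C_prim_root_exists pl_gt0.
have [iota Dv] := cyclotomic_embedding zF vP.
exists X, Y; split; last by move=> i; exists (horner (map_poly i u0)).
- apply: (@map_mx_inj _ _ iota); rewrite map_mx_expr map_mx1.
  exact: induced_action_exprX (XY iota).
- apply: (@map_mx_inj _ _ iota); rewrite map_mx_expr map_mx1.
  (* The power is (Y^m)^(p^(n-k)) = z^(p^(n-k)), which is 1 because l <= n - k. *)
  rewrite (totient_pfactor_mul p_pr k_in) mulnC exprM.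
  rewrite (induced_action_scalar p_pr k_in rgen p_r (XY iota)).
  rewrite -rmorphXn -(rmorphXn iota) /=.
  rewrite -(subnK le_l) expnD mulnC exprM (prim_expr_order zP) expr1n.
  by rewrite rmorph1.
apply: (@map_mx_inj _ _ iota); rewrite -!mulmxE !map_mxM map_mx_expr !mulmxE.
exact: induced_action_conj p_pr k_in rgen p_r (XY iota).
Qed.

(** * The holomorph *)

(** Automorphisms of [C] correspond to units mod p^n through their exponents; [r] is the exponent of
    a generator of the cyclic group [Aut C]. *)
Lemma Aut_cyclic_odd_pgroup (gT : finGroupType) (C : {group gT}) p n :
  prime p -> odd p -> (0 < n)%N -> cyclic C -> #|C| = (p ^ n)%N ->
  exists (g : {perm gT}) (r : nat),
  [/\ Aut C = <[g]>%g, coprime p r,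
      {in C, forall x, g x = x ^+ r}%g &
      forall b, coprime p b -> exists j, b = r ^ j %[mod p ^ n]].
Proof.
move=> p_pr p_odd n_gt0 cycC oC.
have q_gt1 : (1 < p ^ n)%N by rewrite -(exp1n n) ltn_exp2r ?prime_gt1.
have pC : (p.-group C)%g by rewrite /pgroup oC pnatX pnat_id.
have ntC : C :!=: 1%g by rewrite -cardG_gt1 oC.
have [mA [[actA [_ _] [_ imA] expA _] [_ cycF _ _] strA]] :=
  cyclic_pgroup_Aut_structure pC cycC ntC.
have /cyclicP[g Dg] : cyclic (Aut C).
  (* If #|C| = p, then [Aut C] equals its p'-core, which is cyclic; otherwise cyclicity comes from p
     being odd. *)
  move: strA; case: ifP => [_ -> //| _ [t [_ _ _]]].
  by rewrite p_odd => -[[]].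
have Ag : g \in Aut C by rewrite Dg cycle_id.
clear strA; rewrite oC in mA actA imA expA *.
exists g, (mA g).
have DmA : mA g = (val (mA g))%:R by rewrite natr_Zp.
split=> //.
- have: mA g \in GRing.unit by rewrite -imA; apply: image_f.
  by rewrite {1}DmA unitZpE // coprime_pexpl.
- by move=> x Cx; rewrite -actA.
move=> b p_b; have: (b%:R : 'Z_(p ^ n)) \in GRing.unit by rewrite unitZpE ?coprime_pexpl.
rewrite -imA => /imageP[a]; rewrite Dg => /cycleP[j ->].
rewrite expA // {1}DmA -natrX => /(congr1 val) /=.
rewrite !val_Zp_nat // => Db.
by exists j.
Qed.

Lemma holomorph_presentation (gT : finGroupType) (C : {group gT}) p n :
  prime p -> odd p -> (0 < n)%N -> cyclic C -> #|C| = (p ^ n)%N ->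
  exists (x y : holomorph C) (r : nat),
  [/\ [/\ x ^+ (p ^ n) = 1, y ^+ totient (p ^ n) = 1 & x * y = y * x ^+ r]%g,
      (forall h : holomorph C, exists i j, h = y ^+ j * x ^+ i)%g,
      #|holomorph C| = (totient (p ^ n) * p ^ n)%N,
      coprime p r &
      forall b, coprime p b -> exists j, b = r ^ j %[mod p ^ n]].
Proof.
move=> p_pr p_odd n_gt0 cycC oC.
have [g [r [DA p_r gE rgen]]] := Aut_cyclic_odd_pgroup p_pr p_odd n_gt0 cycC oC.
have /cyclicP[c Dc] := cycC.
have Ag : g \in Aut C by rewrite DA cycle_id.
have Cc : c \in C by rewrite Dc cycle_id.
have oA : #|Aut C| = totient (p ^ n) by rewrite card_Aut_cyclic // oC.
have cN : (c ^+ (p ^ n) = 1)%g by rewrite -oC Dc expg_order.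
have gM : (g ^+ totient (p ^ n) = 1)%g by rewrite -oA DA expg_order.
have powA a : a \in Aut C -> exists j, a = (g ^+ j)%g.
  by rewrite DA => /cycleP.
have powC x : x \in C -> exists i, x = (c ^+ i)%g by rewrite {1}Dc => /cycleP.
pose to := [Aut C]%gact.
exists (sdpair1 to c), (sdpair2 to g), r; split=> //.
- split.
  + by rewrite -morphX // cN morph1.
  + by rewrite -morphX // gM morph1.
  rewrite conjgC -(sdpair_act to) // -morphX //; congr (_ * sdpair1 _ _)%g.
  by rewrite /= /autact /= apermE gE.
- move=> h; rewrite (sdpairE h); case: h => [[a x] /= /setXP[Aa Cx]].
  by have [[j ->] [i ->]] := (powA a Aa, powC x Cx); exists i, j; rewrite /= !morphX.
have /sdprod_card := sdprod_sdpair to.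
rewrite cardsT => <-; rewrite (card_injm (injm_sdpair1 to)) //.
rewrite (card_injm (injm_sdpair2 to)) //.
by rewrite oC oA mulnC.
Qed.

(** * Maps out of the group algebra *)

Section MetacyclicLift.

Variables (gT : finGroupType) (x y : gT) (r M N : nat).
Hypotheses (xN : (x ^+ N = 1)%g) (yM : (y ^+ M = 1)%g) (xy : (x * y = y * x ^+ r)%g).
Hypothesis xy_gen : (forall g, exists i j, g = y ^+ j * x ^+ i)%g.
Hypothesis oG : #|gT| = (M * N)%N.

(** Choosing exponents for each element is injective, hence bijective since the group has order M
    N. *)
Lemma metacyclic_coordinates : exists e : gT -> 'I_M * 'I_N,
  bijective e /\ forall g, (g = y ^+ (e g).1 * x ^+ (e g).2)%g.
Proof.
have /andP[M0 N0] : (0 < M)%N && (0 < N)%N.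
  by rewrite -muln_gt0 -oG; apply/card_gt0P; exists 1%g.
have ex g : {e : 'I_M * 'I_N | g == y ^+ e.1 * x ^+ e.2}%g.
  apply/sigW; have [i [j ->]] := xy_gen g.
  exists (Ordinal (ltn_pmod j M0), Ordinal (ltn_pmod i N0)) => /=.
  by rewrite !expg_mod.
pose e g := sval (ex g).
have eE g : (g = y ^+ (e g).1 * x ^+ (e g).2)%g.
  by rewrite /e; case: (ex g) => p /= /eqP.
exists e; split=> //; apply: inj_card_bij => [g g' Eg|].
  by rewrite (eE g) Eg -eE.
by rewrite card_prod !card_ord oG.
Qed.

Variables (e : gT -> 'I_M * 'I_N).
Hypothesis e_bij : bijective e.
Hypothesis eE : forall g, (g = y ^+ (e g).1 * x ^+ (e g).2)%g.

Lemma coordinates_expg (i : 'I_N) (j : 'I_M) : e (y ^+ j * x ^+ i)%g = (j, i).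
Proof.
have [e' eK e'K] := e_bij.
by have:= eE (e' (j, i)); rewrite e'K /= => <-; rewrite e'K.
Qed.

Lemma metacyclic_conj j i : (x ^+ i * y ^+ j = y ^+ j * x ^+ (i * r ^ j))%g.
Proof.
have xyi k : (x ^+ k * y = y * x ^+ (k * r))%g.
  elim: k => [|k IHk]; first by rewrite mul1g mulg1.
  by rewrite expgS -mulgA IHk mulgA xy -mulgA -expgD mulSn.
elim: j i => [|j IHj] i; first by rewrite muln1 mul1g mulg1.
by rewrite expgS mulgA xyi -mulgA IHj mulgA expnS mulnA.
Qed.

Variables (B : pzRingType) (X Y : B).
Hypotheses (XN : X ^+ N = 1) (YM : Y ^+ M = 1) (XY : X * Y = Y * X ^+ r).

Lemma metacyclic_ring_conj j i : X ^+ i * Y ^+ j = Y ^+ j * X ^+ (i * r ^ j).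
Proof.
have XYi k : X ^+ k * Y = Y * X ^+ (k * r).
  elim: k => [|k IHk]; first by rewrite !expr0 mul1r mulr1.
  by rewrite exprS -mulrA IHk mulrA XY -mulrA -exprD mulSn.
elim: j i => [|j IHj] i; first by rewrite muln1 expr0 mul1r mulr1.
by rewrite exprS mulrA XYi -mulrA IHj mulrA expnS mulnA.
Qed.

Definition metacyclic_rep g : B := Y ^+ (e g).1 * X ^+ (e g).2.

Lemma metacyclic_repE i j : metacyclic_rep (y ^+ j * x ^+ i)%g = Y ^+ j * X ^+ i.
Proof.
have [M0 N0] : (0 < M)%N /\ (0 < N)%N.
  by have [[j' lt_j] [i' lt_i]] := e 1%g; split; [case: M lt_j | case: N lt_i].
rewrite -(expg_mod j yM) -(expg_mod i xN) /metacyclic_rep.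
rewrite (coordinates_expg (Ordinal (ltn_pmod i N0)) (Ordinal (ltn_pmod j M0))) /=.
by rewrite (expr_mod j YM) (expr_mod i XN).
Qed.

Lemma metacyclic_rep1 : metacyclic_rep 1%g = 1.
Proof. by rewrite -[1%g](mulg1 (y ^+ 0)%g) (metacyclic_repE 0 0) !expr0 mulr1. Qed.

(** The same commutation rule brings products to the form y^j x^i in the group and Y^j X^i in the
    ring; [metacyclic_repE] accepts unreduced exponents. *)
Lemma metacyclic_repM g h :
  metacyclic_rep (g * h)%g = metacyclic_rep g * metacyclic_rep h.
Proof.
rewrite [g]eE [h]eE; set j := (e g).1; set i := (e g).2.
set j' := (e h).1; set i' := (e h).2.
rewrite !metacyclic_repE -mulgA (mulgA (x ^+ i)%g) metacyclic_conj.
rewrite -mulgA -expgD mulgA -expgD metacyclic_repE.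
by rewrite -mulrA (mulrA (X ^+ i)) metacyclic_ring_conj -mulrA -exprD mulrA -exprD.
Qed.

End MetacyclicLift.

Section GroupAlgebraLift.

(* The target is a ring and a module; it cannot be asked to be an algebra since
   [algType] excludes the zero ring. *)
Variables (R : comNzRingType) (gT : finGroupType) (B : pzRingType).
Variables (s : R -> B -> B) (rho : gT -> B).
Hypotheses (sDl : forall u, {morph s^~ u : a b / a + b}).
Hypotheses (sDr : forall a, {morph s a : u v / u + v}).
Hypotheses (sA : forall a b u, s a (s b u) = s (a * b) u).
Hypotheses (s1 : forall u, s 1 u = u).
Hypotheses (sAl : forall a u v, s a (u * v) = s a u * v).
Hypotheses (sAr : forall a u v, s a (u * v) = u * s a v).
Hypotheses (rho1 : rho 1%g = 1) (rhoM : {morph rho : g h / (g * h)%g >-> g * h}).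
Local Notation RG := (group_algebra R gT).

Definition galg_lift (h : RG) : B := \sum_g s (h g) (rho g).

Let s0r a : s a 0 = 0.
Proof. by apply: (addIr (s a 0)); rewrite -sDr !add0r. Qed.

Let s0l u : s 0 u = 0.
Proof. by apply: (addIr (s 0 u)); rewrite -sDl !add0r. Qed.

Lemma galg_lift_linear a h h' :
  galg_lift (a *: h + h') = s a (galg_lift h) + galg_lift h'.
Proof.
rewrite (big_morph _ (sDr a) (s0r a)) -big_split; apply: eq_bigr => g _.
by rewrite !ffunE sDl sA.
Qed.

Lemma galg_lift1 : galg_lift 1 = 1.
Proof.
rewrite /galg_lift (bigD1 1%g) //= ffunE eqxx s1 rho1 big1 ?addr0 // => g /negPf g1.
by rewrite ffunE g1 s0l.
Qed.

Lemma galg_liftM : {morph galg_lift : h h' / h * h'}.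
Proof.
move=> h h'; rewrite /galg_lift mulr_suml.
under [LHS]eq_bigr => g _.
  rewrite ffunE (big_morph (s^~ (rho g)) (sDl _) (s0l _)).
  over.
rewrite exchange_big; apply: eq_bigr => u _ /=.
rewrite mulr_sumr (reindex_inj (mulgI u)); apply: eq_bigr => v _ /=.
by rewrite mulKg rhoM -sA sAr sAl.
Qed.

End GroupAlgebraLift.

Lemma galg_lift_metacyclic (R : comNzRingType) (gT : finGroupType) (B : pzRingType)
    (s : R -> B -> B) (x y : gT) M N (e : gT -> 'I_M * 'I_N) (X Y : B)
    (h : group_algebra R gT) :
  bijective e -> (forall g, g = y ^+ (e g).1 * x ^+ (e g).2)%g ->
  galg_lift s (metacyclic_rep e X Y) h =
  \sum_(j < M) \sum_(i < N) s (h (y ^+ j * x ^+ i)%g) (Y ^+ j * X ^+ i).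
Proof.
move=> e_bij eE; rewrite pair_big /= (reindex e); last exact: onW_bij.
by apply: eq_bigr => g _; rewrite -eE.
Qed.

(** * Dimension count *)

Section Separating.

Variable F : fieldType.

(** A way to say that dim V is at most #|J| for a mere [lmodType], as the matrix algebras and direct
    sums are here. *)
Definition separating (V : lmodType F) (J : finType) (phi : J -> V -> F) :=
  (forall j, scalar (phi j)) /\ (forall v, (forall j, phi j v = 0) -> v = 0).

Lemma separating_vect (V : vectType F) :
  exists phi : 'I_(\dim {:V}) -> V -> F, separating phi.
Proof.
exists (fun j v => coord (vbasis {:V}) j v); split=> [j a u v|v v0].
  exact: linearP.
by rewrite (coord_vbasis (memvf v)) big1 // => j _; rewrite v0 scale0r.
Qed.

Lemma separating_matrix (A : lmodType F) (J : finType) (phi : J -> A -> F) (m : nat) :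
  separating phi ->
  exists psi : ('I_m * 'I_m * J)%type -> matrix_algebra A m -> F, separating psi.
Proof.
move=> [phi_lin phi0].
exists (fun j v => phi j.2 ((v : 'M[A]_m) j.1.1 j.1.2)); split=> [j a u v|v v0].
  by rewrite !mxE phi_lin.
by apply/matrixP => i i'; rewrite mxE; apply: phi0 => j; exact: (v0 (i, i', j)).
Qed.

Lemma separating_direct_sum (I : finType) (A : I -> lmodType F) (J : I -> finType) :
  (forall i, exists phi : J i -> A i -> F, separating phi) ->
  exists psi : {i : I & J i} -> direct_sum A -> F, separating psi.
Proof.
move=> /fin_all_exists[phi phiP].
exists (fun j (v : direct_sum (fun i => A i)) => phi (tag j) (tagged j) (v (tag j))).
split=> [j a u v|v v0].
  by rewrite !ffunE (phiP _).1.
apply/ffunP => i; rewrite ffunE; apply: (phiP i).2 => j.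
exact: (v0 (Tagged J j)).
Qed.

Lemma separating_pair (U V : lmodType F) (J J' : finType)
    (phi : J -> U -> F) (phi' : J' -> V -> F) :
  separating phi -> separating phi' ->
  exists psi : J + J' -> (U * V)%type -> F, separating psi.
Proof.
move=> [lin phi0] [lin' phi'0].
exists (fun j v => match j with inl j => phi j v.1 | inr j => phi' j v.2 end).
split=> [[j|j] a u v | [u v] uv0]; rewrite ?lin ?lin' //.
congr (_, _); [apply: phi0 => j; exact: (uv0 (inl j))|].
by apply: phi'0 => j; exact: (uv0 (inr j)).
Qed.

End Separating.

(** Composing [f] with the functionals gives a #|gT| by #|J| matrix with independent rows. As #|J|
    <= #|gT| it has full column rank, so the functionals of any v are matched by some f(h), and
    separation gives f(h) = v. *)
Lemma galg_inj_surj (F : fieldType) (gT : finGroupType) (V : lmodType F)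
    (f : group_algebra F gT -> V) (J : finType) (phi : J -> V -> F) :
  linear f -> (forall h, f h = 0 -> h = 0) -> separating phi -> (#|J| <= #|gT|)%N ->
  forall v, exists h, f h = v.
Proof.
move=> f_lin f_inj [phi_lin phi0] leJ.
pose fL : {linear group_algebra F gT -> V} :=
  HB.pack f (GRing.isLinear.Build F (group_algebra F gT) V _ f f_lin).
pose phiL j : {scalar V} :=
  HB.pack (phi j) (GRing.isLinear.Build F V F _ (phi j) (phi_lin j)).
pose h (u : 'rV[F]_#|gT|) : group_algebra F gT := [ffun g => u 0 (enum_rank g)].
pose M : 'M[F]_(#|gT|, #|J|) := \matrix_(i, j) phi (enum_val j) (f (h (delta_mx 0 i))).
have phi_h u j : phi j (f (h u)) = (u *m M) 0 (enum_rank j).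
  have -> : h u = \sum_i u 0 i *: h (delta_mx 0 i).
    apply/ffunP => g; rewrite ffunE sum_ffunE (bigD1 (enum_rank g)) //=.
    rewrite !ffunE !mxE !eqxx mulr1.
    rewrite big1 ?addr0 // => i /negPf gi.
    by rewrite !ffunE !mxE eq_sym gi andbF mulr0.
  rewrite -[f _]/(fL _) linear_sum -[phi j _]/(phiL j _) linear_sum mxE.
  by apply: eq_bigr => i _; rewrite !linearZ !mxE enum_rankK.
have M_free : row_free M.
  apply: inj_row_free => u uM; apply/rowP => i.
  have /f_inj/ffunP/(_ (enum_val i)) : f (h u) = 0.
    by apply: phi0 => j; rewrite phi_h uM mxE.
  by rewrite !ffunE enum_valK mxE.
have M_full : row_full M.
  by rewrite /row_full eqn_leq rank_leq_col (eqP M_free).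
move=> v; have /submxP[u Du] : (\row_j phi (enum_val j) v <= M)%MS by rewrite submx_full.
exists (h u); apply/eqP; rewrite -subr_eq0; apply/eqP/phi0 => j.
rewrite -[phi j _]/(phiL j _) linearB /= phi_h -Du mxE enum_rankK; exact: subrr.
Qed.

Lemma big_seq_sub (s : seq nat) (G : nat -> nat) :
  uniq s -> (\sum_(k : seq_sub s) G (ssval k) = \sum_(k <- s) G k)%N.
Proof.
move=> us; rewrite -(big_map (@ssval _ s) xpredT G); apply: perm_big.
apply: uniq_perm => //.
  by rewrite (map_inj_uniq val_inj) index_enum_uniq.
move=> k; apply/mapP/idP => [[x _ ->]|sk]; first exact: ssvalP.
by exists (SeqSub sk); rewrite ?mem_index_enum.
Qed.

Lemma sum_totient_pfactor p m : prime p ->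
  (\sum_(l < m.+1) totient (p ^ l) = p ^ m)%N.
Proof.
move=> p_pr; elim: m => [|m IHm]; first by rewrite big_ord_recl big_ord0.
rewrite big_ord_recr /= IHm totient_pfactor //= expnS.
by rewrite -{1}[(p ^ m)%N]mul1n -mulnDl add1n prednK ?prime_gt0.
Qed.

(** With M = phi(p^n), the fields contribute M, and each k contributes phi(p^k)^2 p^(n-k) = M
    phi(p^k). The total is M times the sum of phi(p^k) over 0 <= k <= n. *)
Lemma sum_wedderburn_dims p n : prime p -> (0 < n)%N ->
  (\sum_(d : seq_sub (divisors (totient (p ^ n)))) totient (ssval d) +
   \sum_(k : seq_sub (index_iota 1 n.+1)) \sum_(l < (n - ssval k).+1)
     totient (p ^ ssval k) * totient (p ^ ssval k) * totient (p ^ l))%N =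
  (totient (p ^ n) * p ^ n)%N.
Proof.
move=> p_pr n_gt0; set M := totient (p ^ n).
have M_gt0 : (0 < M)%N by rewrite totient_gt0 expn_gt0 prime_gt0.
rewrite (big_seq_sub totient) ?divisors_uniq //.
have -> : (\sum_(d <- divisors M) totient d = M)%N.
  rewrite -[RHS]sum_totient_dvd -(big_mkord (dvdn^~ M) totient) -[RHS]big_filter.
  apply: perm_big; apply: uniq_perm; rewrite ?divisors_uniq ?filter_uniq ?iota_uniq //.
  move=> d; rewrite mem_filter mem_index_iota /= -dvdn_divisors //.
  by case: (boolP (d %| M)%N) => // /(dvdn_leq M_gt0); rewrite ltnS => ->.
pose G k := (\sum_(l < (n - k).+1) totient (p ^ k) * totient (p ^ k) * totient (p ^ l))%N.
rewrite (big_seq_sub G) ?iota_uniq //.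
rewrite (eq_big_seq (fun k => M * totient (p ^ k))%N) => [|k]; last first.
  rewrite mem_index_iota ltnS => k_in.
  rewrite /G -big_distrr /= sum_totient_pfactor // /M.
  by rewrite (totient_pfactor_mul p_pr k_in) [LHS]mulnC mulnA.
rewrite -big_distrr /= -{1}[M]muln1 -mulnDr; congr (_ * _)%N.
rewrite -[RHS]sum_totient_pfactor // -[RHS](big_mkord xpredT (fun l => totient (p ^ l))).
by rewrite [RHS]big_ltn.
Qed.

Lemma poly_unity_roots_eq0 N (q : {poly algC}) :
  (size q <= N)%N -> (forall v, v ^+ N = 1 -> q.[v] = 0) -> q = 0.
Proof.
move=> szq q0; have [N0|N_gt0] := posnP N.
  by apply/eqP; rewrite -size_poly_eq0 -leqn0 -N0.
have [w wP] := C_prim_root_exists N_gt0.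
apply: (@roots_geq_poly_eq0 _ _ [seq w ^+ i | i : 'I_N]).
- apply/allP => _ /imageP[i _ ->]; apply/eqP/q0.
  by rewrite exprAC (prim_expr_order wP) expr1n.
- apply/injectiveP => i j /eqP; rewrite (eq_prim_root_expr wP) !modn_small //.
  by move/eqP/val_inj.
by rewrite size_map size_enum_ord.
Qed.

(** * Injectivity *)

Lemma rmorph_scale_rat (K : fieldExtType rat) (iota : {rmorphism K -> algC}) a x :
  iota (a *: x) = ratr a * iota x.
Proof.
rewrite -mulr_algl rmorphM /=; congr (_ * _).
exact: (fmorph_eq_rat (iota \o in_alg K)).
Qed.

(** For fixed j the polynomial with coefficients c(j,i) is shown to vanish at every p^n-th root of
    unity w. At w = 1 its value is a coefficient of a polynomial in v killed by all M-th roots of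
    unity, M = phi(p^n); at w of order p^k, k > 0, of one killed by all p^(n-k)-th roots. *)
Lemma coefficients_eq0 p n (c : nat -> nat -> algC) :
  prime p ->
  (forall v, v ^+ totient (p ^ n) = 1 ->
     \sum_(j < totient (p ^ n)) (\sum_(i < p ^ n) c j i) * v ^+ j = 0) ->
  (forall k w v, (0 < k <= n)%N -> (p ^ k).-primitive_root w ->
     v ^+ (p ^ (n - k)) = 1 -> forall j : 'I_(totient (p ^ k)),
     \sum_(t < p ^ (n - k))
       (\sum_(i < p ^ n) c (t * totient (p ^ k) + j)%N i * w ^+ i) * v ^+ t = 0) ->
  forall j i, (j < totient (p ^ n))%N -> (i < p ^ n)%N -> c j i = 0.
Proof.
move=> p_pr H1 H2 j i lt_j lt_i.
have N_gt0 : (0 < p ^ n)%N by rewrite expn_gt0 prime_gt0.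
have vanish (L : nat) (G : nat -> algC) :
    (forall v, v ^+ L = 1 -> \sum_(t < L) G t * v ^+ t = 0) ->
    forall t, (t < L)%N -> G t = 0.
  move=> G0 t lt_t; have: \poly_(t < L) G t = 0.
    apply: (poly_unity_roots_eq0 (size_poly _ _)) => v vL.
    by rewrite horner_poly; exact: G0.
  by move/(congr1 (fun q : {poly algC} => q`_t)); rewrite coef_poly lt_t coef0.
apply: (vanish (p ^ n)%N (c j)) => // w wN.
have [d wP] := prim_order_exists N_gt0 wN.
case/(dvdn_pfactor _ _ p_pr) => k le_kn Dd; rewrite {d}Dd in wP.
have [k0|k_gt0] := posnP k.
  move: wP; rewrite k0 expn0 => /prim_expr_order; rewrite expr1 => ->.
  under eq_bigr do rewrite expr1n mulr1.
  by apply: (vanish _ (fun j => \sum_(i < p ^ n) c j i) H1).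
have k_in : (0 < k <= n)%N by rewrite k_gt0.
have m_gt0 : (0 < totient (p ^ k))%N by rewrite totient_gt0 expn_gt0 prime_gt0.
rewrite (divn_eq j (totient (p ^ k))).
pose j0 := Ordinal (ltn_pmod j m_gt0).
apply: (vanish _ (fun t => \sum_(i < p ^ n) c (t * totient (p ^ k) + j0)%N i * w ^+ i)).
  by move=> v vL; apply: H2.
by rewrite ltn_divLR // -(totient_pfactor_mul p_pr k_in).
Qed.

End Preliminaries.

(** * Assembling the isomorphism from its components *)

Theorem theorem8p0p1 (p n : nat) (gT : finGroupType) (C : {group gT})
    (K : nat -> fieldExtType rat) (zeta : forall m : nat, K m) :
  prime p -> odd p -> (1 <= n)%N ->
  cyclic C -> #|C| = (p ^ n)%N ->
  (forall m : nat, (1 <= m)%N -> cyclotomic_extension m (zeta m)) ->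
  exists f : {lrmorphism group_algebra rat (holomorph C) ->
    direct_sum (fun d : seq_sub (divisors (totient (p ^ n))) => K (ssval d)) *
    direct_sum (fun k : seq_sub (index_iota 1 n.+1) =>
      direct_sum (fun l : 'I_(n - ssval k).+1 =>
        matrix_algebra (K (p ^ l)%N) (totient (p ^ ssval k))))},
    bijective f.
Proof.
Local Open Scope ring_scope.
move=> p_pr p_odd n_gt0 cycC oC zetaP.
have [x [y [r [[xN yM xy] xy_gen oG p_r rgen]]]] :=
  holomorph_presentation p_pr p_odd n_gt0 cycC oC.
have [e [e_bij eE]] := metacyclic_coordinates xN yM xy_gen oG.
have M_gt0 : (0 < totient (p ^ n))%N by rewrite totient_gt0 expn_gt0 prime_gt0.
have pl_gt0 l : (0 < p ^ l)%N by rewrite expn_gt0 prime_gt0.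
have kP (k : seq_sub (index_iota 1 n.+1)) : (0 < ssval k <= n)%N.
  by have:= ssvalP k; rewrite mem_index_iota ltnS.
have dP (d : seq_sub (divisors (totient (p ^ n)))) : (ssval d %| totient (p ^ n))%N.
  by have:= ssvalP d; rewrite -dvdn_divisors.
have dE (d : seq_sub (divisors (totient (p ^ n)))) :
    cyclotomic_extension (ssval d) (zeta (ssval d)).
  exact/zetaP/(dvdn_gt0 M_gt0)/dP.
(* Bundling the two matrices into a pair lets them be chosen for all k and l at once, the index sets
   being finite. *)
pose P k l (XY : 'M[K (p ^ l)%N]_(totient (p ^ k)) * 'M[K (p ^ l)%N]_(totient (p ^ k))) :=
  [/\ XY.1 ^+ (p ^ n) = 1, XY.2 ^+ totient (p ^ n) = 1, XY.1 * XY.2 = XY.2 * XY.1 ^+ r &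
   forall iota : {rmorphism K (p ^ l)%N -> algC}, exists u : algC -> algC,
     @induced_action p k r (iota (zeta (p ^ l)%N)) u
       (map_mx iota XY.1) (map_mx iota XY.2)].
have XYex (k : seq_sub (index_iota 1 n.+1)) : exists XY : forall l : 'I_(n - ssval k).+1,
    'M[K (p ^ l)%N]_(totient (p ^ ssval k)) * 'M[K (p ^ l)%N]_(totient (p ^ ssval k)),
    forall l : 'I_(n - ssval k).+1, P (ssval k) l (XY l).
  have XYexl (l : 'I_(n - ssval k).+1) : exists XY, P (ssval k) l XY.
    have [X [Y XYP]] := exists_induced_rep p_pr p_odd (kP k) (leq_ord l) rgen p_r
      (zetaP _ (pl_gt0 l)).
    by exists (X, Y).
  exact: (fin_all_exists XYexl).
have [XY XYP] := fin_all_exists XYex.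
pose lift_d (d : seq_sub (divisors (totient (p ^ n)))) :
    group_algebra rat (holomorph C) -> K (ssval d) :=
  galg_lift *:%R (metacyclic_rep e 1 (zeta (ssval d))).
pose lift_kl (k : seq_sub (index_iota 1 n.+1)) (l : 'I_(n - ssval k).+1) :
    group_algebra rat (holomorph C) ->
    matrix_algebra (K (p ^ l)%N) (totient (p ^ ssval k)) :=
  @galg_lift _ _ (matrix_algebra (K (p ^ l)%N) (totient (p ^ ssval k))) *:%R
    (metacyclic_rep e (XY k l).1 (XY k l).2).
have lift_d_alg d :
    [/\ linear (lift_d d), lift_d d 1 = 1 & {morph lift_d d : h h' / h * h'}].
  have X1 : (1 : K (ssval d)) ^+ (p ^ n) = 1 by rewrite expr1n.
  have YM : zeta (ssval d) ^+ totient (p ^ n) = 1.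
    by have [zP _] := dE d; apply/eqP; rewrite -(prim_order_dvd zP) dP.
  have XYr : 1 * zeta (ssval d) = zeta (ssval d) * 1 ^+ r by rewrite expr1n mulr1 mul1r.
  split.
  - move=> a h h'; apply: galg_lift_linear.
    + exact: scalerDl. + exact: scalerDr. + exact: scalerA.
  - apply: galg_lift1.
    + exact: scalerDl. + exact: scale1r. + exact: (metacyclic_rep1 xN yM e_bij eE X1 YM).
  apply: galg_liftM.
  - exact: scalerDl. - exact: scalerA. - exact: scalerAl. - exact: scalerAr.
  exact: (metacyclic_repM xN yM xy e_bij eE X1 YM XYr).
have lift_kl_alg k (l : 'I_(n - ssval k).+1) :
    [/\ linear (@lift_kl k l), lift_kl k l 1 = 1 & {morph @lift_kl k l : h h' / h * h'}].
  have [XN YM XYr _] := XYP k l.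
  split.
  - move=> a h h'; apply: galg_lift_linear.
    + exact: scalerDl. + exact: scalerDr. + exact: scalerA.
  - apply: galg_lift1.
    + exact: scalerDl. + exact: scale1r. + exact: (metacyclic_rep1 xN yM e_bij eE XN YM).
  apply: galg_liftM.
  - exact: scalerDl. - exact: scalerA. - exact: matalg_scaleAl.
  - exact: matalg_scaleAr.
  exact: (metacyclic_repM xN yM xy e_bij eE XN YM XYr).
pose A_d := direct_sum (fun d : seq_sub (divisors (totient (p ^ n))) => K (ssval d)).
pose A_k (k : seq_sub (index_iota 1 n.+1)) := direct_sum (fun l : 'I_(n - ssval k).+1 =>
  matrix_algebra (K (p ^ l)%N) (totient (p ^ ssval k))).
pose T := (A_d * direct_sum A_k)%type.
pose f (h : group_algebra rat (holomorph C)) : T :=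
  ([ffun d => lift_d d h], [ffun k => [ffun l => lift_kl k l h] : A_k k]).
have f_lin : linear f.
  move=> a h h'; congr (_, _); apply/ffunP => d; rewrite !ffunE.
    by have [-> _ _] := lift_d_alg d.
  by apply/ffunP => l; rewrite !ffunE; have [-> _ _] := lift_kl_alg d l.
have f1 : f 1 = 1.
  congr (_, _); apply/ffunP => d; rewrite !ffunE.
    by have [_ -> _] := lift_d_alg d.
  by apply/ffunP => l; rewrite !ffunE; have [_ -> _] := lift_kl_alg d l.
have fM : {morph f : h h' / h * h'}.
  move=> h h'; congr (_, _); apply/ffunP => d; rewrite !ffunE.
    by have [_ _ ->] := lift_d_alg d.
  by apply/ffunP => l; rewrite !ffunE; have [_ _ ->] := lift_kl_alg d l.
have f_inj h : f h = 0 -> h = 0.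
  move=> fh0.
  have lift_d0 d : lift_d d h = 0.
    by have /(congr1 fst)/ffunP/(_ d) := fh0; rewrite !ffunE.
  have lift_kl0 k (l : 'I_(n - ssval k).+1) : lift_kl k l h = 0.
    have /(congr1 snd)/ffunP/(_ k) := fh0.
    by rewrite !ffunE => /ffunP/(_ l); rewrite !ffunE.
  apply/ffunP => g; rewrite ffunE (eE g).
  apply: (fmorph_inj (ratr : {rmorphism rat -> algC})).
  rewrite rmorph0.
  apply: (coefficients_eq0 (c := fun j i => ratr (h (y ^+ j * x ^+ i)%g)) p_pr) => //.
    (* The order d of v divides phi(p^n), so an embedding sends [zeta d] to v and the d-th component
       of f(h) gives the equation at v. *)
    move=> v vM; have [d vP d_M] := prim_order_exists M_gt0 vM.
    have d_in : d \in divisors (totient (p ^ n)) by rewrite -dvdn_divisors.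
    pose dd := SeqSub d_in.
    have [iota Dv] := cyclotomic_embedding (dE dd) vP.
    have /(congr1 iota) := lift_d0 dd.
    rewrite /lift_d (galg_lift_metacyclic _ _ _ _ e_bij eE) rmorph0 => lift0.
    rewrite -[RHS]lift0 rmorph_sum; apply: eq_bigr => j _; rewrite rmorph_sum mulr_suml.
    apply: eq_bigr => i _.
    by rewrite rmorph_scale_rat expr1n mulr1 rmorphXn Dv.
  move=> k w v k_in wP vL j.
  have L_gt0 : (0 < p ^ (n - k))%N by exact: pl_gt0.
  (* The order of v is p^l with l <= n - k, which is exactly the range of l for this k; an embedding
     sends the chosen root of unity to v. *)
  have [l' vP] := prim_order_exists L_gt0 vL.
  case/(dvdn_pfactor _ _ p_pr) => l le_l Dl; rewrite {l'}Dl in vP.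
  have k_iota : k \in index_iota 1 n.+1 by rewrite mem_index_iota ltnS.
  pose kk := SeqSub k_iota.
  pose ll : 'I_(n - ssval kk).+1 := Ordinal (le_l : l < (n - k).+1)%N.
  have [iota Dv] := cyclotomic_embedding (zetaP _ (pl_gt0 l)) vP.
  have [_ _ _ /(_ iota)[u uXY]] := XYP kk ll.
  rewrite -Dv; apply: (@induced_action_free p n r k _ u _ _ p_pr k_in rgen p_r uXY
    (fun j i => ratr (h (y ^+ j * x ^+ i)%g))) => //.
    rewrite Dv; apply: contra_eq_neq (prim_expr_order vP) => ->.
    by rewrite expr0n gtn_eqF // eq_sym oner_eq0.
  have := lift_kl0 kk ll.
  rewrite /lift_kl (galg_lift_metacyclic _ _ _ _ e_bij eE) => lift0.
  have := congr1 (map_mx iota) lift0.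
  rewrite map_mx0 => lift1; rewrite -[RHS]lift1.
  rewrite raddf_sum; apply: eq_bigr => j' _; rewrite raddf_sum; apply: eq_bigr => i _.
  rewrite -!map_mx_expr -mulmxE -map_mxM; apply/matrixP => a b.
  by rewrite !mxE; exact: esym (rmorph_scale_rat iota _ _).
have f_surj v : exists h, f h = v.
  have [phi_d phi_dP] : exists phi : {d : seq_sub (divisors (totient (p ^ n))) &
      'I_(\dim {:K (ssval d)})} -> A_d -> rat, separating phi.
    by apply: separating_direct_sum => d; exact: separating_vect.
  have [phi_k phi_kP] : exists phi : {k : seq_sub (index_iota 1 n.+1) &
      {l : 'I_(n - ssval k).+1 &
        ('I_(totient (p ^ ssval k)) * 'I_(totient (p ^ ssval k)) *
        'I_(\dim {:K (p ^ l)%N}))%type}} -> direct_sum A_k -> rat, separating phi.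
    apply: separating_direct_sum => k; apply: separating_direct_sum => l.
    by have [phi phiP] := separating_vect (K (p ^ l)%N); exact: separating_matrix phiP.
  have [phi phiP] := separating_pair phi_dP phi_kP.
  (* It remains to bound the number of functionals, the sum of the dimensions of the components, by
     the order of the group. *)
  apply: (galg_inj_surj f_lin f_inj phiP).
  rewrite oG -(sum_wedderburn_dims p_pr n_gt0) card_sum !card_tagged !sumnE !big_map.
  rewrite -!enumT !big_enum /=; apply: leq_add; apply: leq_sum.
    by move=> d _; rewrite card_ord; apply: cyclotomic_dim (dE d).
  move=> k _.
  rewrite card_tagged sumnE big_map big_enum; apply: leq_sum => l _.
  rewrite !card_prod !card_ord leq_mul2l; apply/orP; right.
  exact: cyclotomic_dim (zetaP _ (pl_gt0 l)).
pose lin := GRing.isLinear.Build rat (group_algebra rat (holomorph C)) T _ f f_lin.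
pose mul := GRing.isMonoidMorphism.Build (group_algebra rat (holomorph C)) T f (f1, fM).
pose fL : {lrmorphism group_algebra rat (holomorph C) -> T} := HB.pack f lin mul.
exists fL.
have f_surjb v : exists h, f h == v by have [h <-] := f_surj v; exists h.
exists (fun v => xchoose (f_surjb v)) => [h|v]; last exact/eqP/(xchooseP (f_surjb v)).
apply/eqP; rewrite -subr_eq0; apply/eqP/f_inj.
rewrite -[f _]/(fL _) rmorphB /=; apply/eqP; rewrite subr_eq0.
exact: (xchooseP (f_surjb (f h))).
Qed.
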